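(* Let $k$ be any positive integer, and let $\alpha=p_\alpha/q_\alpha$ and $\beta=p_\beta/q_\beta$ be rational constants (with $p_\alpha,q_\alpha,p_\beta,q_\beta$ positive integers) such that $0<\alpha<\beta<1-\alpha<1$. Put $a_1=q_\alpha^{k-1}$, $b_1=q_\beta^{k-1}$, and for $i=1,\ldots,k$ let $a_i=a_1(2-\alpha^{i-1})$ and $b_i=b_1\beta^{i-1}$. Then $$f(x,y)=\sum_{i=1}^k x^{a_i}y^{b_i}$$ is an irreducible polynomial (in particular all $a_i$ and $b_i$ are positive integers).
   Context: Big-oh in two variables: for real functions $f(n_1,n_2)$ and $g(n_1,n_2)$ of nonnegative arguments, $f(n_1,n_2)=O(g(n_1,n_2))$ means there exist positive constants $c$, $n_{1,0}$, $n_{2,0}$ such that $f(n_1,n_2)\le c\,g(n_1,n_2)$ for all $n_1,n_2\ge 0$ satisfying $n_1\ge n_{1,0}$ or $n_2\ge n_{2,0}$. A term is a product of single-variable functions (here each $x^{a_i}y^{b_i}$). Given terms $T_1,\ldots,T_k$ and $S=T_1+\cdots+T_k$, the term $T_i$ is independent with respect to $S$ if $T_i=O(S-T_i)$ does not hold; $S$ is irreducible if every $T_i$ is independent with respect to $S$. *)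

(* Defs.v *)
From mathcomp Require Import all_boot all_order all_algebra.
From mathcomp Require Import reals.
Set Implicit Arguments.
Unset Strict Implicit.
Unset Printing Implicit Defensive.
Import Order.TTheory GRing.Theory Num.Theory.
Local Open Scope ring_scope.

(* Functions of nonnegative real arguments are total functions on R that are
   only ever tested at nonnegative points. *)
Definition bigO2 (R : realType) (f g : R -> R -> R) : Prop :=
  exists c x0 y0 : R, [/\ 0 < c, 0 < x0, 0 < y0 &
    forall x y : R, 0 <= x -> 0 <= y -> x0 <= x \/ y0 <= y ->
      f x y <= c * g x y].

Record term (R : realType) := Term { term_fst : R -> R; term_snd : R -> R }.

Definition term_eval (R : realType) (T : term R) (x y : R) : R :=
  term_fst T x * term_snd T y.

Definition monomial_term (R : realType) (a b : nat) : term R :=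
  Term (fun x : R => x ^+ a) (fun y : R => y ^+ b).

Definition term_sum (R : realType) (k : nat) (T : 'I_k -> term R) (x y : R) : R :=
  \sum_(i < k) term_eval (T i) x y.

Definition independent_term (R : realType) (k : nat) (T : 'I_k -> term R)
    (i : 'I_k) : Prop :=
  ~ bigO2 (term_eval (T i)) (fun x y => term_sum T x y - term_eval (T i) x y).

(* Irreducibility of T_1 + ... + T_k, as a property of the family of its terms. *)
Definition irreducible_sum (R : realType) (k : nat) (T : 'I_k -> term R) : Prop :=
  forall i : 'I_k, independent_term T i.

(* Main.v *)
Require Import Defs.
From mathcomp Require Import all_boot all_order all_algebra.
From mathcomp Require Import reals.
From mathcomp Require Import ring lra zify.
Set Implicit Arguments.
Unset Strict Implicit.
Unset Printing Implicit Defensive.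
Import Order.TTheory GRing.Theory Num.Theory.
Local Open Scope ring_scope.

(** A monomial x^(a_i) y^(b_i) is independent as soon as some weights P > 0 and
    Q >= 0 make P a_j + Q b_j strictly maximal at j = i: along the curve
    (x, y) = (t^P, t^Q) that monomial dominates the sum of all the others.
    Up to a constant, u a_j + v b_j = v b_1 beta^j - u a_1 alpha^j, whose
    increment at j is u a_1 (1 - alpha) alpha^j - v b_1 (1 - beta) beta^j.
    As alpha < beta, the increments change sign at most once, from positive to
    negative, and u / v can be tuned to place this change exactly at j = i. *)

Lemma independent_of_strict_max (R : realType) (k : nat) (m n : 'I_k -> nat)
    (i : 'I_k) (P Q : nat) :
  (0 < P)%N ->
  (forall j, j != i -> (P * m j + Q * n j < P * m i + Q * n i)%N) ->
  independent_term (fun j => monomial_term R (m j) (n j)) i.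
Proof.
move=> P_gt0 imax [c [x0 [y0 [c_gt0 x0_gt0 y0_gt0 domO]]]].
(* The summand [x0] puts the point beyond the threshold in [x] (through [0 < P]), and [c * k%:R < t]
   lets one extra factor [t] outweigh all the other terms at once. *)
pose t : R := 1 + x0 + c * k%:R.
have ck_ge0 : 0 <= c * k%:R by rewrite mulr_ge0 ?ler0n ?ltW.
have t_ge1 : 1 <= t by rewrite /t; lra.
have t_gt0 : 0 < t by lra.
have x0_le : x0 <= t ^+ P.
  by apply: (@le_trans _ _ t); [rewrite /t; lra | rewrite ler_eXnr].
have /(_ (or_introl x0_le)) :=
  domO (t ^+ P) (t ^+ Q) (exprn_ge0 _ (ltW t_gt0)) (exprn_ge0 _ (ltW t_gt0)).
have evalE j : term_eval (monomial_term R (m j) (n j)) (t ^+ P) (t ^+ Q)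
    = t ^+ (P * m j + Q * n j).
  by rewrite /term_eval /= -!exprM exprD.
rewrite /term_sum (bigD1 i) //= addrC addrK evalE.
set D := (P * m i + Q * n i)%N in imax *.
apply/negP; rewrite -ltNge.
have rest_le : \sum_(j < k | j != i)
    term_eval (monomial_term R (m j) (n j)) (t ^+ P) (t ^+ Q)
    <= k%:R * t ^+ D.-1.
  apply: (@le_trans _ _ (\sum_(j < k | j != i) t ^+ D.-1)).
    apply: ler_sum => j /imax jD; rewrite evalE ler_weXn2l //; lia.
  rewrite sumr_const mulr_natl ler_wpMn2l ?exprn_ge0 ?(ltW t_gt0) //.
  by rewrite -[leqRHS](card_ord k) max_card.
(* If [D = 0] the bound with [D.-1] gains no factor [t], but no exponent lies below [0]: there are
   no other terms and the sum is empty. *)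
have [D0|D_gt0] := posnP D.
  rewrite D0 expr0 big_pred0 ?mulr0 // => j.
  by apply/negbTE/negP => /imax; rewrite D0.
apply: (@le_lt_trans _ _ (c * (k%:R * t ^+ D.-1))); first by rewrite ler_pM2l.
rewrite -[in ltRHS](prednK D_gt0) exprS mulrA ltr_pM2r ?exprn_gt0 //.
by rewrite /t; lra.
Qed.

Lemma unimodal_strict_max (R : numDomainType) (s : nat -> R) (i : nat) :
  (forall j, (j < i)%N -> s j < s j.+1) ->
  (forall j, (i <= j)%N -> s j.+1 < s j) ->
  forall j, j != i -> s j < s i.
Proof.
move=> incr decr.
have below d : (d < i)%N -> s (i - d.+1)%N < s i.
  elim: d => [|d IHd] di.
    by have := incr i.-1; rewrite subn1 prednK //; apply; lia.
  apply: lt_trans (IHd _); last by lia.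
  by have := incr (i - d.+2)%N; rewrite -subSn // subSS; apply; lia.
have above d : s (i + d.+1)%N < s i.
  elim: d => [|d IHd]; first by rewrite addn1; apply: decr.
  by apply: lt_trans IHd; rewrite addnS; apply: decr; lia.
move=> j; rewrite neq_ltn => /orP[ji|ij].
  have -> : j = (i - (i - j.+1).+1)%N by lia.
  by apply: below; lia.
by have -> : j = (i + (j - i.+1).+1)%N by lia.
Qed.

Lemma geometric_strict_max (R : realFieldType) (alpha beta A B : R) (i : nat) :
  0 < A -> 0 < B -> 0 < alpha -> alpha < beta -> beta < 1 ->
  exists u v : R, [/\ 0 < u, 0 < v & forall j, j != i ->
    u * (A * (2 - alpha ^+ j)) + v * (B * beta ^+ j)
    < u * (A * (2 - alpha ^+ i)) + v * (B * beta ^+ i)].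
Proof.
move=> A_gt0 B_gt0 alpha_gt0 ltab beta_lt1.
have beta_gt0 : 0 < beta by lra.
have a1 : 0 < 1 - alpha by lra.
have b1 : 0 < 1 - beta by lra.
(* The denominators cancel the constants of the increments. The ratio of the numerators uses the
   midpoint of [alpha] and [beta], so that the sign changes between the steps [i - 1] and [i], with
   no zero increment. *)
pose u := beta ^+ i * (alpha + beta) / (A * (1 - alpha)).
pose v := 2 * beta * alpha ^+ i / (B * (1 - beta)).
have ai := exprn_gt0 i alpha_gt0; have bi := exprn_gt0 i beta_gt0.
have ab_gt0 : 0 < alpha + beta by lra.
exists u, v; split; first by rewrite /u divr_gt0 ?mulr_gt0.
  by rewrite /v divr_gt0 ?mulr_gt0.
pose s j := u * (A * (2 - alpha ^+ j)) + v * (B * beta ^+ j).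
have stepE j : s j.+1 - s j
    = beta ^+ i * (alpha + beta) * alpha ^+ j - 2 * beta * alpha ^+ i * beta ^+ j.
  by rewrite /s /u /v !exprS; field; rewrite !gt_eqF.
have pow_le d : alpha ^+ d <= beta ^+ d by rewrite lerXn2r ?nnegrE //; lra.
(* With common powers factored out, the cases reduce to [2 * alpha * alpha ^+ d < (alpha + beta) *
   beta ^+ d] and [(alpha + beta) * alpha ^+ d < 2 * beta * beta ^+ d]. As [d] may be [0],
   strictness comes from the linear factors. *)
apply: (@unimodal_strict_max _ s) => j ji; rewrite -subr_gt0.
  rewrite stepE -(subnKC ji) addSnnS !exprD !exprS subr_gt0.
  set d := (i - j.+1)%N.
  rewrite [ltLHS](_ : _ = alpha ^+ j * beta ^+ j * beta * (2 * alpha * alpha ^+ d)); last by ring.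
  rewrite [ltRHS](_ : _ = alpha ^+ j * beta ^+ j * beta * ((alpha + beta) * beta ^+ d)); last by ring.
  rewrite ltr_pM2l ?mulr_gt0 ?exprn_gt0 //.
  have := pow_le d; have := exprn_gt0 d alpha_gt0; nra.
rewrite -opprB stepE opprB -(subnKC ji) !exprD subr_gt0.
set d := (j - i)%N.
rewrite [ltLHS](_ : _ = alpha ^+ i * beta ^+ i * ((alpha + beta) * alpha ^+ d)); last by ring.
rewrite [ltRHS](_ : _ = alpha ^+ i * beta ^+ i * (2 * beta * beta ^+ d)); last by ring.
rewrite ltr_pM2l ?mulr_gt0 //.
have := pow_le d; have := exprn_gt0 d alpha_gt0; nra.
Qed.

Lemma pos_ratE (u : rat) : 0 < u ->
  exists p d : nat, [/\ (0 < p)%N, (0 < d)%N & u = p%:R / d%:R].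
Proof.
move=> u_gt0; exists `|numq u|%N, `|denq u|%N; split.
- by rewrite absz_gt0 numq_eq0 gt_eqF.
- by rewrite absz_gt0 denq_eq0.
by rewrite !natr_absz !ger0_norm ?divq_num_den // numq_ge0 ltW.
Qed.

(** Integrality of the exponents: [q ^ N] absorbs the denominator [q ^ i]. *)
Lemma natr_expMdiv (F : numFieldType) (p q N i : nat) : (0 < q)%N -> (i <= N)%N ->
  q%:R ^+ N * (p%:R / q%:R) ^+ i = (p ^ i * q ^ (N - i))%:R :> F.
Proof.
move=> q_gt0 iN; have q0 : q%:R != 0 :> F by rewrite pnatr_eq0 -lt0n.
rewrite natrM !natrX -{1}(subnKC iN) exprD expr_div_n.
by field; rewrite expf_neq0.
Qed.

Theorem theorem2 (R : realType) (k pa qa pb qb : nat) (alpha beta : rat)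
    (a b : 'I_k -> rat)
    (k_gt0 : (0 < k)%N)
    (pa_gt0 : (0 < pa)%N) (qa_gt0 : (0 < qa)%N)
    (pb_gt0 : (0 < pb)%N) (qb_gt0 : (0 < qb)%N)
    (alphaE : alpha = pa%:R / qa%:R) (betaE : beta = pb%:R / qb%:R)
    (alpha_gt0 : 0 < alpha) (alpha_lt_beta : alpha < beta)
    (beta_lt : beta < 1 - alpha) (alphaC_lt1 : 1 - alpha < 1)
    (aE : forall i : 'I_k, a i = qa%:R ^+ k.-1 * (2 - alpha ^+ i))
    (bE : forall i : 'I_k, b i = qb%:R ^+ k.-1 * beta ^+ i) :
  exists m n : 'I_k -> nat,
    [/\ forall i : 'I_k, (0 < m i)%N /\ a i = (m i)%:R,
        forall i : 'I_k, (0 < n i)%N /\ b i = (n i)%:R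
      & irreducible_sum (fun i : 'I_k => monomial_term R (m i) (n i))].
Proof.
have beta_lt1 : beta < 1 by lra.
have alpha_lt1 : alpha < 1 by lra.
pose N := k.-1.
have leN (i : 'I_k) : (i <= N)%N by have := ltn_ord i; rewrite /N; lia.
pose e (i : 'I_k) := (pa ^ i * qa ^ (N - i))%N.
(* The subtraction never truncates: [e i <= qa ^ N] because [alpha < 1], which also gives
   [m i > 0]. *)
pose m (i : 'I_k) := (2 * qa ^ N - e i)%N.
pose n (i : 'I_k) := (pb ^ i * qb ^ (N - i))%N.
have A_gt0 : 0 < qa%:R ^+ N :> rat by rewrite exprn_gt0 ?ltr0n.
have B_gt0 : 0 < qb%:R ^+ N :> rat by rewrite exprn_gt0 ?ltr0n.
have eE (i : 'I_k) : qa%:R ^+ N * alpha ^+ i = (e i)%:R by rewrite alphaE natr_expMdiv.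
have e_le i : (e i <= qa ^ N)%N.
  rewrite -(ler_nat rat) -eE natrX ler_piMr ?(ltW A_gt0) //.
  by rewrite exprn_ile1 ?ltW.
have qaN_gt0 : (0 < qa ^ N)%N by rewrite expn_gt0 qa_gt0.
have amE i : a i = (m i)%:R.
  rewrite aE -/N mulrBr eE /m natrB; last by have := e_le i; lia.
  by rewrite natrM natrX mulrC.
have bnE i : b i = (n i)%:R by rewrite bE betaE natr_expMdiv.
exists m, n; split=> [i|i|i].
- by split=> //; have := e_le i; rewrite /m; lia.
- by split=> //; rewrite muln_gt0 !expn_gt0 pb_gt0 qb_gt0.
(* The weights are sought in [rat], not in [R], so that clearing denominators turns them into
   natural exponents for the curve. *)
have [u [v [u_gt0 v_gt0 imax]]] :=
  geometric_strict_max i A_gt0 B_gt0 alpha_gt0 alpha_lt_beta beta_lt1.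
have [p [d [p_gt0 d_gt0 uE]]] := pos_ratE u_gt0.
have [q [d' [q_gt0 d'_gt0 vE]]] := pos_ratE v_gt0.
have d0 : d%:R != 0 :> rat by rewrite pnatr_eq0 -lt0n.
have d'0 : d'%:R != 0 :> rat by rewrite pnatr_eq0 -lt0n.
have dd'_gt0 : 0 < (d * d')%:R :> rat by rewrite ltr0n muln_gt0 d_gt0.
(* These are [u = p / d] and [v = q / d'] scaled by [d * d']. *)
apply: (@independent_of_strict_max _ _ _ _ _ (p * d') (q * d)).
  by rewrite muln_gt0 p_gt0.
have scoreE (j : 'I_k) : (p * d' * m j + q * d * n j)%:R
    = (d * d')%:R * (u * (qa%:R ^+ N * (2 - alpha ^+ j))
                     + v * (qb%:R ^+ N * beta ^+ j)).
  rewrite -aE -bE amE bnE uE vE natrD !natrM; field; exact/andP.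
by move=> j ji; rewrite -(ltr_nat rat) !scoreE ltr_pM2l //; apply: imax.
Qed.
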